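(* Let $T$ be a tree without leaves that has uniformly bounded growth, i.e. $\overline{\mathrm{gr}}<\infty$. Let $B$ be the non-backtracking operator of $T$. Then $$\sigma(B)\subset\{\lambda\in\mathbb{C}: 1\le|\lambda|\le\sqrt{\overline{\mathrm{gr}}}\}.$$
   Context: For a graph, let $M_r=\sup_v|\mathrm{Ball}(v,r)|$, where $\mathrm{Ball}(v,r)$ is the set of vertices at graph distance at most $r$ from $v$. Define $\overline{\mathrm{gr}}=\limsup_{r\to\infty}M_r^{1/r}$. $E(T)$ is the set of directed edges (each undirected edge gives two opposite directed edges). For directed edges, $e\to e'$ means the head of $e$ is the tail of $e'$ and $e'$ is not the reverse of $e$. $B$ acts on $\ell^2(E(T))$ by $(Bf)(e)=\sum_{e'\colon e\to e'}f(e')$. We write $\sigma(B)=\{\lambda: B-\lambda I\text{ has no bounded inverse}\}$. *)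

(* Defs.v *)
From HB Require Import structures.
From mathcomp Require Import all_boot all_order all_algebra finmap complex.
From mathcomp Require Import all_classical all_reals all_analysis ring.

Set Implicit Arguments.
Unset Strict Implicit.
Unset Printing Implicit Defensive.

Import Order.TTheory GRing.Theory Num.Theory.
Import numFieldNormedType.Exports.
Import ComplexField.Normc.

Local Open Scope classical_set_scope.
Local Open Scope ring_scope.
Local Open Scope complex_scope.

Section Ell2.
Variables (R : realType) (I : choiceType).
Implicit Types f g : I -> R[i].

Definition sqsum f : \bar R := (\esum_(i in [set: I]) (normc (f i) ^+ 2)%:E)%E.

Definition square_summable : {pred I -> R[i]} :=
  [pred f | (sqsum f < +oo)%E].

Lemma sqsum_ge0 f : (0 <= sqsum f)%E.
Proof. by apply: esum_ge0 => i _; rewrite lee_fin sqr_ge0. Qed.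

Lemma sqsum_le f (c : R) :
  (forall A : {fset I}, \sum_(i <- A) normc (f i) ^+ 2 <= c) ->
  (sqsum f <= c%:E)%E.
Proof.
move=> H; apply: ge_ereal_sup => _ [A [finA _] <-].
by rewrite fsbig_finite//= sumEFin lee_fin.
Qed.

Lemma sqsum_ge f (A : {fset I}) : f \in square_summable ->
  \sum_(i <- A) normc (f i) ^+ 2 <= fine (sqsum f).
Proof.
rewrite inE/= => fs; rewrite -lee_fin fineK; last first.
  by rewrite ge0_fin_numE// sqsum_ge0.
apply: ereal_sup_ubound; exists [set` A]; first by split.
by rewrite fsbig_finite//= set_fsetK sumEFin.
Qed.

Lemma square_summableP f (c : R) :
  (forall A : {fset I}, \sum_(i <- A) normc (f i) ^+ 2 <= c) ->
  f \in square_summable.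
Proof. by move/sqsum_le => H; rewrite inE/= (le_lt_trans H)// ltry. Qed.

Lemma normcD_sqr (t : R) (x y : R[i]) : 0 < t ->
  normc (x + y) ^+ 2 <= (1 + t) * normc x ^+ 2 + (1 + t^-1) * normc y ^+ 2.
Proof.
move=> t0; have tv : t * t^-1 = 1 by rewrite divff// gt_eqF.
have tv0 : 0 < t^-1 by rewrite invr_gt0.
have h : normc (x + y) <= normc x + normc y by have /andP[_] := ComplexField.lec_normD x y.
have xy0 : 0 <= normc (x + y) by case: (x + y) => a b /=; rewrite sqrtr_ge0.
apply: (@le_trans _ _ ((normc x + normc y) ^+ 2)).
  by rewrite lerXn2r// nnegrE// (le_trans xy0).
set a := normc x; set b := normc y.
rewrite -subr_ge0.
have -> : (1 + t) * a ^+ 2 + (1 + t^-1) * b ^+ 2 - (a + b) ^+ 2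
  = t * (a - t^-1 * b) ^+ 2 + (1 - t * t^-1) * (t^-1 * b ^+ 2 - a * b *+ 2).
  by ring.
by rewrite tv subrr mul0r addr0 mulr_ge0 ?sqr_ge0// ltW.
Qed.

Lemma sqsumD_fin (t : R) f g (A : {fset I}) : 0 < t ->
  f \in square_summable -> g \in square_summable ->
  \sum_(i <- A) normc (f i + g i) ^+ 2 <=
  (1 + t) * fine (sqsum f) + (1 + t^-1) * fine (sqsum g).
Proof.
move=> t0 fs gs.
apply: (@le_trans _ _ ((1 + t) * \sum_(i <- A) normc (f i) ^+ 2
                     + (1 + t^-1) * \sum_(i <- A) normc (g i) ^+ 2)).
  by rewrite !mulr_sumr -big_split/= ler_sum// => i _; exact: normcD_sqr.
by rewrite lerD// ler_wpM2l ?sqsum_ge// addr_ge0// ltW// invr_gt0.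
Qed.

Lemma sqsumZ_fin (k : R[i]) f (A : {fset I}) : f \in square_summable ->
  \sum_(i <- A) normc (k * f i) ^+ 2 <= normc k ^+ 2 * fine (sqsum f).
Proof.
move=> fs; under eq_bigr do rewrite normcM exprMn.
by rewrite -mulr_sumr ler_wpM2l ?sqr_ge0// sqsum_ge.
Qed.

Lemma square_summable_submod : submod_closed square_summable.
Proof.
split.
  apply: (@square_summableP _ 0) => A; rewrite big1// => i _.
  by rewrite normc0 expr0n.
move=> k f g fs gs.
have kfs : k *: f \in square_summable by apply: square_summableP => A; exact: sqsumZ_fin.
by apply: square_summableP => A; apply: (@sqsumD_fin 1).
Qed.

HB.instance Definition _ :=
  GRing.isSubmodClosed.Build R[i] (I -> R[i]) square_summable
    square_summable_submod.

Record ell2 := Ell2 {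
  ell2_fun :> I -> R[i];
  ell2_summable : ell2_fun \in square_summable }.

HB.instance Definition _ := [isSub for ell2_fun].
HB.instance Definition _ := [Choice of ell2 by <:].
HB.instance Definition _ := [SubChoice_isSubLmodule of ell2 by <:].

Definition ell2_norm (f : ell2) : R := Num.sqrt (fine (sqsum f)).

Lemma ell2_norm_ge0 (f : ell2) : 0 <= ell2_norm f.
Proof. exact: sqrtr_ge0. Qed.

Lemma ell2_norm_sqr (f : ell2) : ell2_norm f ^+ 2 = fine (sqsum f).
Proof. by rewrite sqr_sqrtr// fine_ge0// sqsum_ge0. Qed.

Lemma ell2_norm_le (f : ell2) (c : R) : 0 <= c ->
  (forall A : {fset I}, \sum_(i <- A) normc (f i) ^+ 2 <= c ^+ 2) ->
  ell2_norm f <= c.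
Proof.
move=> c0 H; rewrite -[leRHS]ger0_norm// -sqrtr_sqr ler_wsqrtr// -lee_fin fineK ?sqsum_le//.
by rewrite ge0_fin_numE ?sqsum_ge0//; have := ell2_summable f; rewrite inE.
Qed.

Lemma ell2_norm0_eq0 (f : ell2) : ell2_norm f = 0 -> f = 0.
Proof.
move=> f0; apply/val_inj/funext => i /=.
have := sqsum_ge [fset i]%fset (ell2_summable f).
rewrite big_seq_fset1 -ell2_norm_sqr f0 expr0n/= => h.
apply: eq0_normc; apply/eqP; rewrite -sqrf_eq0 eq_le h sqr_ge0.
by [].
Qed.

Lemma ell2_normD (f g : ell2) : ell2_norm (f + g) <= ell2_norm f + ell2_norm g.
Proof.
have [/ell2_norm0_eq0->|f0] := eqVneq (ell2_norm f) 0.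
  by rewrite add0r lerDr ell2_norm_ge0.
have [/ell2_norm0_eq0->|g0] := eqVneq (ell2_norm g) 0.
  by rewrite addr0 lerDl ell2_norm_ge0.
have fp : 0 < ell2_norm f by rewrite lt_def f0 ell2_norm_ge0.
have gp : 0 < ell2_norm g by rewrite lt_def g0 ell2_norm_ge0.
apply: ell2_norm_le => [|A]; first by rewrite addr_ge0// ltW.
apply: (le_trans (sqsumD_fin A (divr_gt0 gp fp) (ell2_summable f) (ell2_summable g))).
by rewrite -!ell2_norm_sqr le_eqVlt; apply/orP; left; apply/eqP; field; rewrite f0 g0.
Qed.

Lemma ell2_normZ_le (k : R[i]) (f : ell2) :
  ell2_norm (k *: f) <= normc k * ell2_norm f.
Proof.
have k0 : 0 <= normc k by case: k => a b /=; rewrite sqrtr_ge0.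
apply: ell2_norm_le => [|A]; first by rewrite mulr_ge0// ell2_norm_ge0.
by rewrite exprMn ell2_norm_sqr; exact: (sqsumZ_fin k A (ell2_summable f)).
Qed.

Lemma ell2_normZ (k : R[i]) (f : ell2) :
  ell2_norm (k *: f) = normc k * ell2_norm f.
Proof.
apply/eqP; rewrite eq_le ell2_normZ_le/=.
have [->|k0] := eqVneq k 0; first by rewrite normc0 mul0r ell2_norm_ge0.
have nk0 : 0 < normc k.
  rewrite lt_def; apply/andP; split; last by case: k {k0} => a b /=; rewrite sqrtr_ge0.
  by apply: contra_neq k0 => /eq0_normc.
rewrite -ler_pdivlMl//.
have := ell2_normZ_le k^-1 (k *: f); rewrite scalerA mulVf// scale1r.
by rewrite normcV.
Qed.

(* The norm of a normed module over R[i] takes its values in R[i]. *)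
Definition ell2_cnorm (f : ell2) : R[i] := (ell2_norm f)%:C.

Fact ell2_cnormD (f g : ell2) : ell2_cnorm (f + g) <= ell2_cnorm f + ell2_cnorm g.
Proof. by rewrite /ell2_cnorm -rmorphD lecR ell2_normD. Qed.

Fact ell2_cnormZ (k : R[i]) (f : ell2) : ell2_cnorm (k *: f) = `|k| * ell2_cnorm f.
Proof. by rewrite /ell2_cnorm ell2_normZ rmorphM. Qed.

Fact ell2_cnorm0_eq0 (f : ell2) : ell2_cnorm f = 0 -> f = 0.
Proof. by case=> /ell2_norm0_eq0. Qed.

HB.instance Definition _ := Lmodule_isNormed.Build R[i] ell2
  ell2_cnormD ell2_cnormZ ell2_cnorm0_eq0.

Lemma ell2_normE (f : ell2) :
  `|f| = (Num.sqrt (fine (\esum_(i in [set: I]) (normc (f i) ^+ 2)%:E)%E))%:C.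
Proof. by []. Qed.

Lemma ell2_subZE (f g : ell2) (k : R[i]) i : (f - k *: g) i = f i - k * g i.
Proof. by []. Qed.

End Ell2.
Arguments ell2 : clear implicits.

Section Spectrum.
Variables (K : numFieldType) (W : normedModType K).

Definition has_bounded_inverse (A : W -> W) : Prop :=
  exists S : {linear W -> W},
    [/\ exists M : K, forall x, `|S x| <= M * `|x|, cancel A S & cancel S A].

Definition spectrum (A : W -> W) : set K :=
  [set l | ~ has_bounded_inverse (fun x => A x - l *: x)].

End Spectrum.

Section Graph.
Variables (V : choiceType) (adj : rel V).

Definition simple_graph : Prop := symmetric adj /\ irreflexive adj.

Definition graph_connected : Prop :=
  forall v w, exists2 p : seq V, path adj v p & last v p = w.

Definition graph_acyclic : Prop :=
  forall c : seq V, (2 < size c)%N -> ~~ (cycle adj c && uniq c).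

Definition is_tree : Prop :=
  [/\ simple_graph, inhabited V, graph_connected & graph_acyclic].

Definition is_leaf (v : V) : Prop :=
  exists w, [set u | adj v u] = [set w].

Definition directed_edge : Type := {p : V * V | adj p.1 p.2}.
HB.instance Definition _ := Choice.on directed_edge.

Definition edge_tail (e : directed_edge) : V := (val e).1.
Definition edge_head (e : directed_edge) : V := (val e).2.

Definition nb_follows (e e' : directed_edge) : bool :=
  (edge_head e == edge_tail e') && (val e' != (edge_head e, edge_tail e)).

Section Growth.
Variable R : realType.

Definition graph_dist (v w : V) : \bar R :=
  ereal_inf [set (size p)%:R%:E | p in [set p : seq V | path adj v p /\ last v p = w]].

Definition graph_ball (v : V) (r : nat) : set V :=
  [set w | (graph_dist v w <= r%:R%:E)%E].

Definition max_ball (r : nat) : \bar R :=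
  ereal_sup [set counting (graph_ball v r) | v in [set: V]].

(* The r = 0 term is 1 (as 0^-1 = 0); it does not affect the limsup. *)
Definition upper_growth : \bar R :=
  limn_esup (fun r : nat => poweR (max_ball r) (r%:R^-1)).

(* [\sum_(x \in A)] is a genuine finite sum as soon as A is finite; here A has
   at most deg (edge_head e) elements. *)
Definition nb_sum (f : directed_edge -> R[i]) (e : directed_edge) : R[i] :=
  \sum_(e' \in [set e' | nb_follows e e']) f e'.

(* B as an operator on ell2: [insubd 0 g] is [g] when [g] is square-summable and
   0 otherwise. When [upper_growth] is finite the graph has bounded degree and
   the default is never used: see [nonbacktrackingE]. *)
Definition nonbacktracking (f : ell2 R directed_edge) : ell2 R directed_edge :=
  insubd 0 (nb_sum f).

Lemma max_ball_lty : (upper_growth < +oo)%E ->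
  exists2 r, (0 < r)%N & (max_ball r < +oo)%E.
Proof.
rewrite /upper_growth /limn_esup /limf_esup => /ereal_inf_lt[_ [A [n _ An] <-]] H.
exists n.+1 => //; rewrite ltNge leye_eq; apply/negP => /eqP Mn.
suff : (+oo <= ereal_sup [set poweR (max_ball r) (r%:R^-1) | r in A])%E.
  by rewrite leNgt H.
apply: ereal_sup_ubound; exists n.+1; first by apply: An => /=.
by rewrite Mn poweRyr// invr_eq0 pnatr_eq0.
Qed.

Lemma adj_graph_ball v w r : (0 < r)%N -> adj v w -> graph_ball v r w.
Proof.
move=> r0 vw; apply: (@le_trans _ _ 1%:E); last by rewrite lee_fin ler1n.
by apply: ereal_inf_lbound; exists [:: w] => //=; rewrite vw.
Qed.

Lemma bounded_degree : (upper_growth < +oo)%E ->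
  exists D : nat, forall v, exists2 N : {fset V},
    (forall w, adj v w -> w \in N) & (#|` N| <= D)%N.
Proof.
move=> /max_ball_lty[r r0 Mr].
pose D := Num.bound `|fine (max_ball r)|.
exists D => v; have cM : (counting (graph_ball v r) <= max_ball r)%E.
  by apply: ereal_sup_ubound; exists v.
have : finite_set (graph_ball v r).
  apply: contrapT => infB; move: (le_lt_trans cM Mr).
  by rewrite /counting asboolF.
move=> finB; exists (fset_set (graph_ball v r)) => [w vw|].
  by rewrite in_fset_set// inE; exact: adj_graph_ball.
move: cM; rewrite /counting asboolT// => cM.
rewrite -(@ler_nat R) ltW//; apply: (le_lt_trans (y := fine (max_ball r))).
  by rewrite -lee_fin fineK// fin_real// Mr andbT (lt_le_trans _ cM)// ltNyr.
by apply: (le_lt_trans (ler_norm _)); exact/archi_boundP/normr_ge0.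
Qed.

Lemma normc_sum_sqr (T : eqType) (s : seq T) (f : T -> R[i]) :
  normc (\sum_(x <- s) f x) ^+ 2 <= (size s)%:R * \sum_(x <- s) normc (f x) ^+ 2.
Proof.
elim: s => [|x s IH]; first by rewrite !big_nil normc0 expr0n mulr0.
rewrite !big_cons /=; have [->|s0] := eqVneq s [::].
  by rewrite !big_nil !addr0 mul1r.
have n0 : 0 < (size s)%:R :> R by rewrite ltr0n lt0n size_eq0.
apply: (le_trans (normcD_sqr _ _ n0)).
rewrite -natr1 mulrDr lerD//; first by rewrite addrC.
have -> : 1 + (size s)%:R^-1 = ((size s)%:R + 1) * (size s)%:R^-1 :> R.
  by field; rewrite gt_eqF.
by rewrite -mulrA; apply: ler_wpM2l; [rewrite addr_ge0// ltW|rewrite ler_pdivrMl].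
Qed.

Lemma out_finite (N : {fset V}) e : (forall w, adj (edge_head e) w -> w \in N) ->
  finite_set [set e' | nb_follows e e'].
Proof.
move=> HN; apply: (@sub_finite_set _ _
  ((fun w => insubd e (edge_head e, w)) @` [set` N])); last first.
  exact/finite_image/finite_fset.
move=> [[v w] vw] /andP[/eqP /= ev _]; exists w.
  by apply: HN; rewrite ev.
by apply/val_inj; rewrite /= val_insubd ev /edge_tail/= vw.
Qed.

Lemma key_size (N : {fset V}) (D : nat) (k : directed_edge -> V)
    (s : seq directed_edge) : (#|` N| <= D)%N -> uniq s ->
  {in s &, injective k} -> (forall e, e \in s -> k e \in N) -> (size s <= D)%N.
Proof.
move=> ND us kinj kN; apply: leq_trans ND.
rewrite -(size_map k); apply: uniq_leq_size; first by rewrite map_inj_in_uniq.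
by move=> _ /mapP[e es ->]; exact: kN.
Qed.

Lemma nonbacktrackingE (f : ell2 R directed_edge) e :
  symmetric adj -> (upper_growth < +oo)%E ->
  nonbacktracking f e = \sum_(e' \in [set e' | nb_follows e e']) f e'.
Proof.
move=> sadj /bounded_degree[D HD].
suff fs : nb_sum f \in @square_summable R directed_edge.
  by have := val_insubd (0 : ell2 R directed_edge) (nb_sum f); rewrite fs /= => ->.
pose q e := normc (f e) ^+ 2.
have q0 e1 : 0 <= q e1 by rewrite sqr_ge0.
have finO e1 : finite_set [set e' | nb_follows e1 e'].
  by have [N HN _] := HD (edge_head e1); exact: out_finite HN.
pose O e1 := fset_set [set e' | nb_follows e1 e'].
have inO e1 e' : (e' \in O e1) = nb_follows e1 e'.
  by rewrite in_fset_set//; apply/idP/idP => [/set_mem|/mem_set].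
apply: (@square_summableP _ _ _ (D%:R * (D%:R * fine (sqsum f)))) => A.
apply: (@le_trans _ _ (\sum_(e1 <- A) D%:R * \sum_(e' <- O e1) q e')).
  apply: ler_sum => e1 _; rewrite /nb_sum fsbig_finite//=.
  apply: (le_trans (normc_sum_sqr _ _)); apply: ler_wpM2r.
    by apply: sumr_ge0 => ? _; exact: q0.
  rewrite ler_nat.
  have [N HN ND] := HD (edge_head e1); apply: (key_size (k := edge_head) ND) => //; first exact: fset_uniq.
    move=> [[a b] ab] [[c d] cd]; rewrite !inO => /andP[/eqP/= + _] /andP[/eqP/= + _].
    rewrite /edge_tail /edge_head/= => -> ac bd.
    by apply/val_inj; rewrite /= ac bd.
  move=> [[a b] ab]; rewrite inO => /andP[/eqP/= + _]; rewrite /edge_tail/= => ea.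
  by apply: HN; rewrite ea.
rewrite -mulr_sumr ler_wpM2l//.
pose U := (\bigcup_(e1 <- A) O e1)%fset.
have -> : \sum_(e1 <- A) \sum_(e' <- O e1) q e' =
    \sum_(e1 <- A) \sum_(e' <- U | nb_follows e1 e') q e'.
  apply: eq_big_seq => e1 e1A; rewrite -[RHS]big_filter; apply: perm_big.
  apply: uniq_perm => //; first by apply: filter_uniq; exact: fset_uniq.
  move=> e'; rewrite mem_filter inO; case ee: (nb_follows e1 e') => //=.
  by apply/esym/bigfcupP; exists e1; rewrite ?e1A// inO.
under eq_bigr do rewrite big_mkcond.
rewrite exchange_big/=.
apply: (@le_trans _ _ (\sum_(e' <- U) D%:R * q e')); last first.
  by rewrite -mulr_sumr ler_wpM2l// sqsum_ge// ell2_summable.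
apply: ler_sum => e' _; rewrite -big_mkcond/= -big_filter big_const_seq count_predT.
rewrite iter_addr_0 -[leLHS]mulr_natl ler_wpM2r// ler_nat.
have [N HN ND] := HD (edge_tail e'); apply: (key_size (k := edge_tail) ND) => //.
- by apply: filter_uniq; exact: fset_uniq.
- move=> [[a b] ab] [[c d] cd]; rewrite !mem_filter.
  move=> /andP[/andP[/eqP/= + _] _] /andP[/andP[/eqP/= + _] _].
  rewrite /edge_tail /edge_head/= => <- db ac.
  by apply/val_inj; rewrite /= ac db.
- move=> [[a b] ab]; rewrite mem_filter => /andP[/andP[/eqP/= ea _] _].
  by apply: HN; rewrite -ea sadj.
Qed.

End Growth.
End Graph.
Arguments graph_dist {V} adj R v w.
Arguments graph_ball {V} adj R v r.
Arguments max_ball {V} adj R r.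
Arguments upper_growth {V} adj R.
Arguments nonbacktracking {V} adj R f.

(* Main.v *)
Require Import Defs.
From HB Require Import structures.
From mathcomp Require Import all_boot all_order all_algebra finmap complex.
From mathcomp Require Import all_classical all_reals all_analysis ring.

Set Implicit Arguments.
Unset Strict Implicit.
Unset Printing Implicit Defensive.

Import Order.TTheory GRing.Theory Num.Theory.
Import numFieldNormedType.Exports.
Import ComplexField.Normc.

Local Open Scope classical_set_scope.
Local Open Scope ring_scope.
Local Open Scope complex_scope.

(** Write [q = |lambda|].

If [q < 1]: up to reversal of edges, [B] acts at each vertex of degree [k] as
the matrix [J - 1] on the [k] outgoing edges, where [J] is the all-ones matrix.
Since [k >= 2], it has the inverse [J / (k - 1) - 1], whose norm is at most 1.
So [B] has an inverse [C] of norm at most 1, and [B - lambda = B (1 - lambda C)].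

If [q ^ 2] exceeds the growth: root the tree. An edge pointing away from the
root is followed only by such edges, so [B = L + X], where [L] keeps the
direction and [X] turns from ascending to descending edges. This is a block
triangular decomposition, and it suffices to invert the diagonal part
[L - lambda]. A descending edge has at most one descending predecessor, and an
ascending edge has at most one ascending successor, so in the Schur test for
[L ^ n] one of the two factors is 1 and the other is at most the size [M_n] of
the largest ball of radius [n]: the norm of [L ^ n] is at most [sqrt M_n].
Some [n > 0] has [M_n < q ^ (2 n)], and then [(L / lambda) ^ n] is a strict
contraction. *)

(** * Completeness of ell2 *)

Section Ell2Complete.
Variables (R : realType) (I : choiceType).
Local Notation H := (ell2 R I).
Local Notation Re := (@complex.Re R).
Local Notation Im := (@complex.Im R).
Implicit Types (f g : H) (x : R[i]).

Lemma normc_ge0 x : 0 <= normc x.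
Proof. by case: x => a b /=; rewrite sqrtr_ge0. Qed.

Lemma normc_sqr x : normc x ^+ 2 = Re x ^+ 2 + Im x ^+ 2.
Proof. by case: x => a b /=; rewrite sqr_sqrtr// addr_ge0// sqr_ge0. Qed.

Lemma Re_le_normc x : `|Re x| <= normc x.
Proof.
by rewrite -ler_sqr ?nnegrE ?normc_ge0// real_normK ?num_real// normc_sqr lerDl sqr_ge0.
Qed.

Lemma Im_le_normc x : `|Im x| <= normc x.
Proof.
by rewrite -ler_sqr ?nnegrE ?normc_ge0// real_normK ?num_real// normc_sqr lerDr sqr_ge0.
Qed.

Lemma ell2_norm_coord f i : normc (f i) <= ell2_norm f.
Proof.
rewrite -ler_sqr ?nnegrE ?normc_ge0 ?ell2_norm_ge0// ell2_norm_sqr.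
by have := sqsum_ge [fset i]%fset (ell2_summable f); rewrite big_seq_fset1.
Qed.

Lemma ell2_normN f : ell2_norm (- f) = ell2_norm f.
Proof. by rewrite -scaleN1r ell2_normZ normcN normc1 mul1r. Qed.

Lemma ell2_norm0 : ell2_norm (0 : H) = 0.
Proof. by rewrite -(scale0r (0 : H)) ell2_normZ normc0 mul0r. Qed.

Lemma ell2_normB f g : ell2_norm (f - g) <= ell2_norm f + ell2_norm g.
Proof. by rewrite -(ell2_normN g) ell2_normD. Qed.

Lemma cvg_of_le_dist (u r : R^nat) :
  (forall n k, `|u (n + k)%N - u n| <= r n) -> r @ \oo --> 0 -> cvgn u.
Proof.
move=> ur r0; apply/cauchy_cvgP/cauchy_exP => e e0.
have [n _ /(_ n (leqnn n)) /= rn] := cvgr_lt _ r0 _ e0.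
exists (u n); exists n => // m /= nm.
rewrite /ball/= distrC -(subnKC nm); exact: le_lt_trans (ur _ _) rn.
Qed.

(** Coordinates are Cauchy, so a coordinatewise limit exists. Bounds on finite partial sums survive
    this limit, which gives both membership in [ell2] and the rate [r]. *)
Lemma ell2_complete (v : nat -> H) (r : R^nat) :
  (forall n k, ell2_norm (v (n + k)%N - v n) <= r n) -> r @ \oo --> 0 ->
  exists s : H, forall n, ell2_norm (s - v n) <= r n.
Proof.
move=> vr r0.
have rge0 n : 0 <= r n by apply: le_trans (vr n 0); exact: ell2_norm_ge0.
have vc i n k : normc (v (n + k)%N i - v n i) <= r n.
  by apply: le_trans (vr n k); exact: (ell2_norm_coord (v (n + k)%N - v n)).
have cRe i : cvgn (fun n => Re (v n i)).
  apply: cvg_of_le_dist r0 => n k; rewrite -raddfB.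
  by apply: le_trans (vc i n k); exact: Re_le_normc.
have cIm i : cvgn (fun n => Im (v n i)).
  apply: cvg_of_le_dist r0 => n k; rewrite -raddfB.
  by apply: le_trans (vc i n k); exact: Im_le_normc.
pose s i := limn (fun n => Re (v n i)) +i* limn (fun n => Im (v n i)).
have sv n (A : {fset I}) : \sum_(i <- A) normc (s i - v n i) ^+ 2 <= r n ^+ 2.
  have cA : (fun m => \sum_(i <- A) normc (v m i - v n i) ^+ 2) @ \oo -->
      \sum_(i <- A) normc (s i - v n i) ^+ 2.
    under eq_fun do under eq_bigr do rewrite normc_sqr !raddfB/=.
    under eq_bigr do rewrite normc_sqr !raddfB/=.
    apply: cvg_big => [|i _]; first exact: add_continuous.
    apply: cvgD; rewrite !expr2; apply: cvgM; apply: cvgB; try exact: cvg_cst.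
    - exact: cRe.
    - exact: cRe.
    - exact: cIm.
    - exact: cIm.
  rewrite -(cvg_lim _ cA)//; apply: limr_le; first by apply/cvg_ex; eexists; exact: cA.
  exists n => // m /= nm; rewrite -(subnKC nm).
  apply: le_trans (sqsum_ge A (ell2_summable (v (n + (m - n))%N - v n))) _.
  by rewrite -ell2_norm_sqr ler_sqr ?nnegrE ?ell2_norm_ge0.
(* Only the difference [s - v 0] is directly controlled; adding back [v 0] shows that [s] is
   square-summable. *)
have ss : s \in @square_summable R I.
  have -> : s = (s - v 0) + v 0 by rewrite subrK.
  apply: rpredD; last exact: ell2_summable.
  exact: square_summableP (sv 0%N).
by exists (Ell2 ss) => n; apply: ell2_norm_le => // A; exact: sv.
Qed.

End Ell2Complete.

(** * Invertible operators on ell2 *)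

Section Invertibility.
Variables (R : realType) (I : choiceType).
Local Notation H := (ell2 R I).
Implicit Types (f g : H) (A P L X : {linear H -> H}) (l : R[i]).

(** The inverse is a bare function with a real bound; its linearity is automatic when [T] is linear,
    and is recovered once and for all in [has_bounded_inverse_ell2]. *)
Definition ell2_invertible (T : H -> H) : Prop :=
  exists S : H -> H, [/\ exists2 K, 0 <= K & forall f, ell2_norm (S f) <= K * ell2_norm f,
    cancel T S & cancel S T].

Lemma has_bounded_inverse_ell2 A l : ell2_invertible (fun f => A f - l *: f) ->
  has_bounded_inverse (fun f => A f - l *: f).
Proof.
move=> [S [[K _ SK] AS SA]].
have linS : linear S.
  have SAE h : A (S h) - l *: S h = h := SA h.
  move=> k f g; apply: (can_inj AS); rewrite SA -[in LHS](SAE f) -[in LHS](SAE g).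
  rewrite linearP scalerBr scalerDr !scalerA [l * k]mulrC.
  by rewrite opprD !addrA; congr (_ + _); rewrite -!addrA; congr (_ + _); rewrite addrC.
exists (HB.pack S (GRing.isLinear.Build _ _ _ _ S linS) : {linear H -> H}).
split=> //; exists K%:C => f; rewrite /Num.norm/= /ell2_cnorm -rmorphM lecR.
exact: SK.
Qed.

(** Surjectivity yields a right inverse by choice. The lower bound makes [T] injective, so this
    inverse is two-sided, and bounds it by [K]. *)
Lemma ell2_invertible_intro (T : H -> H) (K : R) : 0 <= K ->
  (forall f g, T (f - g) = T f - T g) ->
  (forall f, ell2_norm f <= K * ell2_norm (T f)) ->
  (forall g, exists f, T f = g) -> ell2_invertible T.
Proof.
move=> K0 TB TK /choice[S TS]; exists S; split => //.
  by exists K => // f; rewrite -{2}(TS f) TK.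
move=> f; apply/eqP; rewrite -subr_eq0; apply/eqP/ell2_norm0_eq0/le_anti.
by rewrite ell2_norm_ge0 andbT (le_trans (TK _))// TB TS subrr ell2_norm0 mulr0.
Qed.

(** The equation is the fixed-point equation [f = g + P f], solved by iteration from 0; the iterates
    are the partial sums of the Neumann series. *)
Lemma contraction_surjective P (q : R) : 0 <= q < 1 ->
  (forall f, ell2_norm (P f) <= q * ell2_norm f) ->
  forall g, exists f, f - P f = g.
Proof.
move=> /andP[q0 q1] Pq g.
have q1' : 0 < 1 - q by rewrite subr_gt0.
pose v n := iter n (fun f => g + P f) 0.
(* [K] is the sum of the geometric series; it satisfies [ell2_norm g + q * K = K], so all iterates
   stay in the ball of radius [K]. *)
pose K := ell2_norm g / (1 - q).
have K0 : 0 <= K by rewrite divr_ge0 ?ell2_norm_ge0// ltW.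
have vK n : ell2_norm (v n) <= K.
  elim: n => [|n IH]; first by rewrite ell2_norm0.
  apply: (le_trans (ell2_normD _ _)).
  apply: (@le_trans _ _ (ell2_norm g + q * K)).
    by rewrite lerD2l (le_trans (Pq _))// ler_wpM2l.
  by rewrite /K le_eqVlt; apply/orP; left; apply/eqP; field; rewrite gt_eqF.
have vq n k : ell2_norm (v (n + k)%N - v n) <= q ^+ n * K.
  elim: n => [|n IH]; first by rewrite subr0 mul1r vK.
  rewrite addSn /v/= opprD addrACA subrr add0r -raddfB (le_trans (Pq _))//.
  by rewrite exprS -mulrA ler_wpM2l.
have q0' : (fun n => q ^+ n * K) @ \oo --> 0.
  by rewrite -(mul0r K); apply: cvgMr_tmp; apply: cvg_expr; rewrite ger0_norm.
have [s sv] := ell2_complete vq q0'.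
exists s; apply/eqP; rewrite -subr_eq0; apply/eqP/ell2_norm0_eq0/le_anti.
rewrite ell2_norm_ge0 andbT leNgt; apply/negP => d0.
(* If the residual had norm [d > 0], take [n] with [q ^+ n * K < d / 2]; yet the residual splits
   into two terms, each of norm at most [q ^+ n * K]. *)
have [n _ /(_ n (leqnn n)) /= nd] := cvgr_lt _ q0' _ (divr_gt0 d0 (ltr0Sn R 1)).
move: nd; rewrite ltr_pdivlMr// ltNge => /negP; apply.
have -> : s - P s - g = (s - v n.+1) - P (s - v n).
  by rewrite /= raddfB opprB opprD !addrA subrK [RHS]addrAC.
rewrite mulrDr mulr1 (le_trans (ell2_normB _ _))// lerD//.
  by rewrite (le_trans (sv _))// ler_wpM2r// exprS ler_piMl ?exprn_ge0 ?(ltW q1).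
rewrite (le_trans (Pq _))// (le_trans (ler_wpM2l q0 (sv n)))//.
by apply: ler_piMl; [exact: mulr_ge0 (exprn_ge0 n q0) K0|exact: ltW].
Qed.

(* [P = l C], with [C] the inverse of [A], is a contraction. *)
Lemma ell2_invertible_inner A C l : normc l < 1 -> cancel A C -> cancel C A ->
  (forall f, ell2_norm (C f) <= ell2_norm f) ->
  ell2_invertible (fun f => A f - l *: f).
Proof.
move=> l1 AC CA Cle.
have l1' : 0 < 1 - normc l by rewrite subr_gt0.
pose lC f : H := l *: C f.
have linlC : linear lC.
  by move=> k f g; rewrite /lC (can2_linear AC CA) scalerDr !scalerA mulrC.
pose P : {linear H -> H} := HB.pack lC (GRing.isLinear.Build _ _ _ _ lC linlC).
have Pl f : ell2_norm (P f) <= normc l * ell2_norm f.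
  by rewrite ell2_normZ ler_wpM2l ?normc_ge0.
apply: (@ell2_invertible_intro _ (1 - normc l)^-1); first by rewrite invr_ge0 ltW.
- by move=> f g; rewrite raddfB scalerBr !opprD !addrA; congr (_ + _); rewrite addrAC.
(* As [f = C (A f)], the norm of [f] is at most that of [A f], hence at most that of [A f - l *: f]
   plus [normc l] times that of [f]. *)
- move=> f; rewrite ler_pdivlMl// mulrBl mul1r lerBlDr.
  rewrite -ell2_normZ -[leLHS](congr1 (@ell2_norm _ _) (AC f)) (le_trans (Cle _))//.
  by rewrite -{1}(subrK (l *: f) (A f)) ell2_normD.
- have l01 : 0 <= normc l < 1 by rewrite normc_ge0.
  move=> g; have [f fg] := contraction_surjective l01 Pl (C g).
  exists f; have -> : l *: f = A (P f) by rewrite /P/= /lC linearZ/= CA.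
  by rewrite -[RHS]CA -fg raddfB.
Qed.

(** Since [1 - A ^ n] is [1 - A] times the sum of the [A ^ k] with [k < n], in either order, both
    the lower bound and the surjectivity of [1 - A ^ n] pass to [1 - A]. *)
Lemma ell2_invertible_power A (M q : R) n : 0 <= M -> 0 <= q < 1 ->
  (forall f, ell2_norm (A f) <= M * ell2_norm f) ->
  (forall f, ell2_norm (iter n A f) <= q * ell2_norm f) ->
  ell2_invertible (fun f => f - A f).
Proof.
move=> M0 q01 AM Aq.
have q1 : 0 < 1 - q by rewrite subr_gt0; case/andP: q01.
have iterB k f g : iter k A (f - g) = iter k A f - iter k A g.
  by elim: k => //= k ->; rewrite raddfB.
have linAn : linear (iter n A).
  by move=> k f g; elim: n {Aq} => //= m ->; rewrite linearP.
pose P : {linear H -> H} :=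
  HB.pack (iter n A) (GRing.isLinear.Build _ _ _ _ (iter n A) linAn).
have AMn k : exists2 K, 0 <= K & forall f, ell2_norm (iter k A f) <= K * ell2_norm f.
  elim: k => [|k [K K0 IH]]; first by exists 1 => // f; rewrite mul1r.
  exists (M * K) => [|f]; first by rewrite mulr_ge0.
  rewrite iterS; apply: le_trans (AM _) _; rewrite -mulrA; exact: ler_wpM2l M0 _ _ (IH f).
have step k f : f - iter k.+1 A f = (f - iter k A f) + iter k A (f - A f).
  by rewrite iterB -iterSr addrA subrK.
have [K K0 AK] : exists2 K, 0 <= K & forall f,
    ell2_norm (f - iter n A f) <= K * ell2_norm (f - A f).
  elim: {Aq linAn P} n => [|k [K K0 IH]].
    by exists 0 => // f; rewrite subrr ell2_norm0 mul0r.
  have [K' K'0 K'A] := AMn k; exists (K + K') => [|f]; first by rewrite addr_ge0.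
  by rewrite step mulrDl (le_trans (ell2_normD _ _))// lerD.
(* The preimage built by the induction is the sum of the [iter k A g] with [k < n]. *)
have range g : exists f, f - A f = g - iter n A g.
  elim: {Aq linAn P AK} n => [|k [f fE]]; first by exists 0; rewrite raddf0 !subrr.
  exists (f + iter k A g); rewrite raddfD opprD addrACA fE -iterS.
  by rewrite addrA subrK.
apply: (@ell2_invertible_intro _ ((1 - q)^-1 * K)).
- by rewrite mulr_ge0// invr_ge0 ltW.
- by move=> f g; rewrite raddfB !opprD !addrA; congr (_ + _); rewrite addrAC.
- move=> f; rewrite -mulrA ler_pdivlMl// mulrBl mul1r lerBlDr.
  rewrite (le_trans _ (lerD (AK f) (Aq f)))//.
  by rewrite -{1}(subrK (iter n A f) f) ell2_normD.
- move=> g; have [h <-] := contraction_surjective (P := P) q01 Aq g.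
  exact: range.
Qed.

(** Factor [A - l] as [- l (1 - A / l)]: the [n]-th power of [A / l] has norm at most
    [c / normc l ^+ n < 1]. *)
Lemma ell2_invertible_outer A l (M c : R) n : (0 < n)%N -> 0 <= M ->
  0 <= c < normc l ^+ n ->
  (forall f, ell2_norm (A f) <= M * ell2_norm f) ->
  (forall f, ell2_norm (iter n A f) <= c * ell2_norm f) ->
  ell2_invertible (fun f => A f - l *: f).
Proof.
move=> n0 M0 /andP[c0 cl] AM Ac.
have ln0 : 0 < normc l ^+ n by exact: le_lt_trans cl.
have l0 : l != 0.
  by apply: contraTneq ln0 => ->; rewrite normc0 expr0n gtn_eqF//= ltxx.
pose lA f : H := l^-1 *: A f.
have linlA : linear lA.
  by move=> k f g; rewrite /lA linearP scalerDr !scalerA mulrC.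
pose A' : {linear H -> H} := HB.pack lA (GRing.isLinear.Build _ _ _ _ lA linlA).
have iterA' k f : iter k A' f = (l ^+ k)^-1 *: iter k A f.
  elim: k => [|k IH]; first by rewrite invr1 scale1r.
  by rewrite iterS IH /A'/= /lA linearZ scalerA exprS invfM.
have normV k : normc (l ^+ k)^-1 = (normc l ^+ k)^-1.
  rewrite normcV; congr (_^-1); elim: k => [|k IH]; first exact: normc1.
  by rewrite !exprS normcM IH.
have q01 : 0 <= c / normc l ^+ n < 1.
  by rewrite divr_ge0 ?(ltW ln0)//= ltr_pdivrMr// mul1r.
have [||f|S [[K K0 SK] AS SA]] := @ell2_invertible_power A' (normc l^-1 * M) _ n _ q01.
- by rewrite mulr_ge0// normc_ge0.
- move=> f; rewrite /A'/= /lA ell2_normZ -mulrA ler_wpM2l ?normc_ge0//; exact: AM.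
- rewrite iterA' ell2_normZ normV mulrAC [leRHS]mulrC.
  by rewrite ler_wpM2l// invr_ge0 ltW.
have TE f : A f - l *: f = - l *: (f - A' f).
  by rewrite /A'/= /lA scalerBr scalerA mulNr divff// scaleN1r scaleNr opprK addrC.
exists (fun f => S ((- l)^-1 *: f)); split.
- exists (K * normc (- l)^-1) => [|f]; first by rewrite mulr_ge0// normc_ge0.
  by rewrite (le_trans (SK _))// ell2_normZ mulrA.
- by move=> f; rewrite /= TE scalerA mulVf ?oppr_eq0// scale1r AS.
- by move=> f; rewrite /= TE SA scalerA divff ?oppr_eq0// scale1r.
Qed.

(* If [R0] is the inverse of [L - l], then [X R0 X = 0], hence
   [(L + X - l)^-1 = R0 - R0 X R0]. *)
Lemma ell2_invertible_triangular L X P l (M : R) : 0 <= M ->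
  (forall f, P (L f) = L (P f)) -> (forall f, X (P f) = X f) ->
  (forall f, P (X f) = 0) -> (forall f, ell2_norm (X f) <= M * ell2_norm f) ->
  ell2_invertible (fun f => L f - l *: f) ->
  ell2_invertible (fun f => L f + X f - l *: f).
Proof.
move=> M0 PL XP PX XM [R0 [[K K0 R0K] LR RL]].
have RLE h : L (R0 h) - l *: R0 h = h := RL h.
have LRE h : R0 (L h - l *: h) = h := LR h.
have RB f g : R0 (f - g) = R0 f - R0 g.
  apply: (can_inj LR); rewrite RL raddfB scalerBr opprB addrACA [- _ + _]addrC.
  by rewrite -[in LHS](RLE f) -[in LHS](RLE g) opprB addrACA [- _ + _]addrC.
have RP f : R0 (P f) = P (R0 f).
  by apply: (can_inj LR); rewrite RL -PL -linearZ -raddfB RLE.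
have R00 : R0 0 = 0 by have := RB 0 0; rewrite !subrr.
(* Insert [P] after the left [X], move it through [R0], and let it kill the right [X]. *)
have XRX f : X (R0 (X f)) = 0 by rewrite -XP -RP PX R00 raddf0.
pose S f := R0 f - R0 (X (R0 f)).
exists S; split.
- exists (K + K * (M * K)) => [|f]; first by rewrite addr_ge0// !mulr_ge0.
  rewrite (le_trans (ell2_normB _ _))// mulrDl lerD// -!mulrA (le_trans (R0K _))//.
  by rewrite ler_wpM2l// (le_trans (XM _))// ler_wpM2l.
- move=> f; rewrite /S.
  have -> : R0 (L f + X f - l *: f) = f + R0 (X f).
    by rewrite addrAC -[X f in LHS]opprK RB LRE -(sub0r (X f)) RB R00 sub0r opprK.
  by rewrite raddfD/= XRX addr0 addrK.
- move=> f; rewrite /S !raddfB/= XRX subr0.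
  have LRE' g : L (R0 g) = g + l *: R0 g by rewrite -{2}(RLE g) subrK.
  rewrite !LRE'; set a := X _; set u := l *: _; set w := l *: _.
  rewrite [- (a + w)]opprD opprK (addrA (f + u)) (addrAC (f + u - a)) subrK.
  by rewrite -(addrA f) [- u + w]addrC -(opprB u w) addrK.
Qed.

End Invertibility.

(** * Operators given by locally finite relations *)

Lemma big_bigfcup_disjoint (R : nmodType) (T I : choiceType) (s : seq I)
    (F : I -> {fset T}) (f : T -> R) : uniq s ->
  {in s &, forall i j x, x \in F i -> x \in F j -> i = j} ->
  \sum_(x <- (\bigcup_(i <- s) F i)%fset) f x = \sum_(i <- s) \sum_(x <- F i) f x.
Proof.
elim: s => [|i s IH]; first by rewrite !big_nil.
move=> /= /andP[iNs us] dF; rewrite !big_cons -IH//; last first.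
  by move=> j k js ks; apply: dF; rewrite inE ?js ?ks orbT.
rewrite -big_cat; apply: perm_big; apply: uniq_perm.
- exact: fset_uniq.
- rewrite cat_uniq !fset_uniq andbT/=; apply/hasPn => x /bigfcupP[j].
  rewrite andbT => js xj; apply/negP => xi; move: iNs.
  by rewrite (dF i j _ _ x xi xj) ?js// inE ?eqxx ?js ?orbT.
- by move=> x; rewrite in_fsetU mem_cat.
Qed.

Section RelationOperator.
Variables (R : realType) (I : choiceType).
Local Notation H := (ell2 R I).
Implicit Types (f g : H) (S : I -> {fset I}).

(** The Schur test for the 0-1 matrix with rows [S i], with row sizes as weights. Testing on finite
    [A] avoids assuming that columns are finite. *)
Definition schur_bound S (c : nat) : Prop := forall j (A : {fset I}),
  (\sum_(i <- A | j \in S i) #|` S i| <= c)%N.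

Lemma schur_bound_sub S S' c : (forall i, {subset S' i <= S i}) ->
  schur_bound S c -> schur_bound S' c.
Proof.
move=> S'S Sc j A; apply: leq_trans (Sc j A).
rewrite big_mkcond [leqRHS]big_mkcond/=; apply: leq_sum => i _.
case: ifP => // jS; rewrite (S'S _ _ jS).
by apply: fsubset_leq_card; apply/fsubsetP/S'S.
Qed.

Lemma schur_bound_mul S a b : (forall i, (#|` S i| <= a)%N) ->
  (forall j (A : {fset I}), (count (fun i => j \in S i) A <= b)%N) ->
  schur_bound S (b * a).
Proof.
move=> Sa Sb j A; apply: (@leq_trans (\sum_(i <- A | j \in S i) a)).
  exact: leq_sum.
by rewrite big_const_seq iter_addn_0 mulnC leq_mul2r Sb orbT.
Qed.

Lemma big_fset_of_sub (A B : {fset I}) (F : I -> R) : {subset A <= B} ->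
  \sum_(i <- A) F i = \sum_(i <- B | i \in A) F i.
Proof.
move=> AB; rewrite -[RHS]big_filter; apply: perm_big; apply: uniq_perm.
- exact: fset_uniq.
- by rewrite filter_uniq ?fset_uniq.
- move=> i; rewrite mem_filter; case iA: (i \in A) => //=.
  by rewrite (AB _ iA).
Qed.

Lemma rel_sum_sqr S c f (A : {fset I}) : schur_bound S c ->
  \sum_(i <- A) normc (\sum_(j <- S i) f j) ^+ 2 <= c%:R * fine (sqsum f).
Proof.
move=> Sc; pose q j := normc (f j) ^+ 2.
have q0 j : 0 <= q j by rewrite sqr_ge0.
apply: (@le_trans _ _ (\sum_(i <- A) \sum_(j <- S i) #|` S i|%:R * q j)).
  by apply: ler_sum => i _; rewrite -mulr_sumr; exact: normc_sum_sqr.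
pose U := (\bigcup_(i <- A) S i)%fset.
rewrite (_ : \sum_(i <- A) _ =
    \sum_(i <- A) \sum_(j <- U) if j \in S i then #|` S i|%:R * q j else 0).
  rewrite exchange_big/=.
  apply: (@le_trans _ _ (\sum_(j <- U) c%:R * q j)).
    apply: ler_sum => j _; rewrite -big_mkcond/= -mulr_suml -natr_sum.
    by rewrite ler_wpM2r// ler_nat Sc.
  by rewrite -mulr_sumr ler_wpM2l// sqsum_ge// ell2_summable.
apply: eq_big_seq => i iA; rewrite (@big_fset_of_sub _ U) ?big_mkcond//.
by move=> j jS; apply/bigfcupP; exists i; rewrite ?iA.
Qed.

(** The default 0 never occurs under a Schur bound, by [rel_opE]. *)
Definition rel_op S f : H := insubd (0 : H) (fun i => \sum_(j <- S i) f j).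

Lemma rel_opE S c f i : schur_bound S c -> rel_op S f i = \sum_(j <- S i) f j.
Proof.
move=> Sc.
have fs : (fun i => \sum_(j <- S i) f j) \in @square_summable R I.
  by apply: square_summableP => A; exact: rel_sum_sqr Sc.
have := val_insubd (0 : H) (fun i => \sum_(j <- S i) f j).
by rewrite fs /rel_op /= => ->.
Qed.

Lemma rel_op_norm S c f : schur_bound S c ->
  ell2_norm (rel_op S f) <= Num.sqrt c%:R * ell2_norm f.
Proof.
move=> Sc; apply: ell2_norm_le => [|A]; first by rewrite mulr_ge0 ?ell2_norm_ge0.
under eq_bigr do rewrite (rel_opE _ _ Sc).
rewrite exprMn ell2_norm_sqr sqr_sqrtr//; exact: rel_sum_sqr.
Qed.

Lemma rel_op_linear S c : schur_bound S c -> linear (rel_op S).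
Proof.
move=> Sc k f g; apply/val_inj/funext => i /=.
rewrite (rel_opE _ _ Sc).
rewrite [RHS](_ : _ = k * rel_op S f i + rel_op S g i)//.
by rewrite !(rel_opE _ _ Sc) mulr_sumr -big_split.
Qed.

Definition rel_lin S c (Sc : schur_bound S c) : {linear H -> H} :=
  HB.pack (rel_op S) (GRing.isLinear.Build _ _ _ _ (rel_op S) (rel_op_linear Sc)).

End RelationOperator.

(** * Rooted trees *)

Section RootedTree.
Variables (V : choiceType) (adj : rel V) (o : V).
Hypothesis treeT : is_tree adj.

Let adj_sym : symmetric adj. Proof. by case: treeT => -[]. Qed.
Let adj_irr : irreflexive adj. Proof. by case: treeT => -[]. Qed.

(** * Depth and parents in a rooted tree *)

Lemma root_path_ex v :
  exists n, `[< exists p, [/\ path adj o p, last o p = v & size p = n] >].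
Proof.
case: treeT => _ _ /(_ o v)[p op pv] _.
by exists (size p); apply/asboolP; exists p.
Qed.

Definition depth v := ex_minn (root_path_ex v).

Lemma depth_path v : exists p, [/\ path adj o p, last o p = v & size p = depth v].
Proof. by rewrite /depth; case: ex_minnP => n /asboolP. Qed.

Lemma depth_last p : path adj o p -> (depth (last o p) <= size p)%N.
Proof.
by move=> op; rewrite /depth; case: ex_minnP => n _; apply; apply/asboolP; exists p.
Qed.

Lemma depth_eq0 v : depth v = 0%N -> v = o.
Proof. by have [p [_ <- <-]] := depth_path v => /size0nil ->. Qed.

Lemma depth_adj v w : adj v w -> (depth w <= (depth v).+1)%N.
Proof.
have [p [op pv <-]] := depth_path v => vw.
have := @depth_last (rcons p w); rewrite last_rcons size_rcons; apply.
by rewrite rcons_path op pv.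
Qed.

Lemma depth_pred v n : depth v = n.+1 -> exists2 u, adj u v & depth u = n.
Proof.
move=> vn; have [p [op pv]] := depth_path v; rewrite vn.
case/lastP: p op pv => // p w; rewrite rcons_path last_rcons size_rcons.
move=> /andP[op uw] wv [pn]; rewrite -{}wv in vn *.
exists (last o p) => //; apply/eqP; rewrite eqn_leq -{1}pn depth_last//=.
by rewrite -ltnS -vn depth_adj.
Qed.

(** Appending [v] to a geodesic of a neighbour one level closer to the root keeps all other vertices
    strictly less deep, so that the path avoids any other vertex at least as deep as [v]. *)
Lemma geodesic v : exists p, [/\ path adj o p, last o p = v &
  forall x, x \in o :: p -> x = v \/ (depth x < depth v)%N].
Proof.
move: {2}(depth v) (erefl (depth v)) => n; elim: n v => [|n IH] v vn.
  by exists [::]; rewrite (depth_eq0 vn); split => // x; rewrite inE => /eqP; left.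
have [u uv un] := depth_pred vn; have [p [op pu pd]] := IH u un.
exists (rcons p v); rewrite rcons_path last_rcons op pu uv; split => // x.
rewrite -rcons_cons mem_rcons in_cons => /orP[/eqP|/pd[->|xu]]; first by left.
  by right; rewrite un vn.
by right; rewrite vn -un ltnW// ltnS.
Qed.

(* Geodesics from the root to [u] and [u'] avoid [v], so together they close a
   cycle through [v]. *)
Lemma parent_uniq v u u' : adj v u -> adj v u' ->
  (depth u <= depth v)%N -> (depth u' <= depth v)%N -> u = u'.
Proof.
move=> vu vu' uv u'v; apply/eqP/negPn/negP => uu'.
have geoN w : adj v w -> (depth w <= depth v)%N ->
    exists p, [/\ path adj o p, last o p = w & v \notin o :: p].
  move=> vw dw; have [p [op pw pd]] := geodesic w; exists p; split => //.
  apply/negP => /pd[vE|]; last by rewrite ltnNge dw.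
  by move: vw; rewrite vE adj_irr.
have [p [op pu vp]] := geoN _ vu uv; have [p' [op' pu' vp']] := geoN _ vu' u'v.
pose q := rev (belast o p) ++ p'.
have lastr : last u (rev (belast o p)) = o.
  by case: (p) pu => //= x s _; rewrite rev_cons last_rcons.
have uq : path adj u q.
  rewrite cat_path lastr op' andbT -pu rev_path.
  by rewrite (eq_path (e' := adj))// => x y; rewrite adj_sym.
have vq : v \notin u :: q.
  rewrite inE negb_or mem_cat mem_rev negb_or -{1}pu.
  move: vp vp'; rewrite lastI mem_rcons inE negb_or => /andP[-> ->].
  by rewrite inE negb_or => /andP[].
have qu' : last u q = u' by rewrite last_cat lastr.
have [_ _ _ acy] := treeT.
(* The walk from [u] through the root to [u'] may repeat vertices; its shortening does not, and
   still avoids [v]. *)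
move: qu' vq; case/shortenP: uq => q' uq' unq' qq' q'u' vq.
have c2 : (2 < size [:: v, u & q'])%N.
  by case: q' q'u' {uq' unq' qq'} => //= q'u'; rewrite q'u' eqxx in uu'.
move/negP: (acy _ c2); apply.
rewrite /= vu rcons_path uq' q'u' adj_sym vu' /= -/(uniq (u :: q')) unq' andbT.
apply: contra vq; rewrite !inE => /orP[->//|/qq' ->]; exact: orbT.
Qed.

(** A neighbour [w] at the same positive depth would coincide with the parent of [v] by
    [parent_uniq]; at depth 0 both vertices would be the root. *)
Lemma depth_neq v w : adj v w -> depth v != depth w.
Proof.
move=> vw; apply/eqP; case vn: (depth v) => [|n] wn.
  by move: vw; rewrite (depth_eq0 vn) (depth_eq0 (esym wn)) adj_irr.
have [u uv un] := depth_pred vn.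
have uw : u = w by apply: (@parent_uniq v) => //; rewrite ?un ?vn -?wn ?(adj_sym v).
by move: wn; rewrite -uw un => /eqP; rewrite eqn_leq ltnn.
Qed.

(** * Directed edges relative to the root *)

Local Notation edge := (directed_edge adj).
Implicit Types e : edge.

Definition descends e : bool := (depth (edge_tail e) < depth (edge_head e))%N.

Lemma edge_adj e : adj (edge_tail e) (edge_head e).
Proof. exact: valP e. Qed.

Lemma ascends_depth e : ~~ descends e -> (depth (edge_head e) < depth (edge_tail e))%N.
Proof. by rewrite -leqNgt leq_eqVlt eq_sym (negbTE (depth_neq (edge_adj e))). Qed.

Lemma edge_eq e e' : edge_tail e = edge_tail e' -> edge_head e = edge_head e' -> e = e'.
Proof.
rewrite /edge_tail /edge_head => tE hE; apply/val_inj.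
by rewrite [LHS]surjective_pairing [RHS]surjective_pairing tE hE.
Qed.

(** The tail of a descending edge is the unique parent of its head. Dually, the next lemma uses that
    the head of an ascending edge is the parent of its tail. *)
Lemma descends_head_inj e e' : descends e -> descends e' -> edge_head e = edge_head e' -> e = e'.
Proof.
move=> de de' hE; apply: edge_eq => //; apply: (@parent_uniq (edge_head e)).
- by rewrite adj_sym edge_adj.
- by rewrite hE adj_sym edge_adj.
- exact: ltnW.
- by rewrite hE ltnW.
Qed.

Lemma ascends_tail_inj e e' : ~~ descends e -> ~~ descends e' ->
  edge_tail e = edge_tail e' -> e = e'.
Proof.
move=> /ascends_depth ue /ascends_depth ue' tE; apply: edge_eq => //.
apply: (@parent_uniq (edge_tail e)).
- exact: edge_adj.
- by rewrite tE edge_adj.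
- exact: ltnW.
- by rewrite tE ltnW.
Qed.

(** An ascending successor would lead back to the parent of the head of [e], that is, it would be
    the reverse of [e]. This makes the operator block triangular. *)
Lemma nb_follows_descends e e' : nb_follows e e' -> descends e -> descends e'.
Proof.
move=> /andP[/eqP ee' ne] de; apply/negPn/negP => /ascends_depth ue'.
move/eqP: ne; apply; rewrite [LHS]surjective_pairing -/(edge_tail e') -/(edge_head e') -ee'.
congr (_, _); apply: (@parent_uniq (edge_head e)).
- by rewrite ee' edge_adj.
- by rewrite adj_sym edge_adj.
- by rewrite ee' ltnW.
- exact: ltnW.
Qed.

(** * Walks that keep their direction *)

Section SameDirection.
Hypothesis finO : forall e, finite_set [set e' | nb_follows e e'].

Definition succs e : {fset edge} := fset_set [set e' | nb_follows e e'].

Lemma in_succs e e' : (e' \in succs e) = nb_follows e e'.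
Proof. by rewrite in_fset_set//; apply/idP/idP => [/set_mem|/mem_set]. Qed.

(** [straight] and [turn] are the relations of the diagonal part [L] and of the off-diagonal part
    [X]. *)
Definition straight e : {fset edge} := [fset e' in succs e | descends e' == descends e]%fset.

Definition turn e : {fset edge} := [fset e' in succs e | descends e' != descends e]%fset.

Lemma in_straight e e' : (e' \in straight e) = nb_follows e e' && (descends e' == descends e).
Proof. by rewrite !inE/= in_succs. Qed.

Lemma in_turn e e' : (e' \in turn e) = nb_follows e e' && (descends e' != descends e).
Proof. by rewrite !inE/= in_succs. Qed.

Lemma turn_descends e e' : e' \in turn e -> ~~ descends e /\ descends e'.
Proof.
rewrite in_turn => /andP[/nb_follows_descends ee']; case: (descends e) ee' => [->//|_].
by case: (descends e').
Qed.

(** The rows of [L ^ n]. A set suffices, without multiplicities, because the union is disjoint by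
    [walk_disjoint]. *)
Fixpoint walk n e : {fset edge} :=
  if n is m.+1 then (\bigcup_(e1 <- straight e) walk m e1)%fset else [fset e]%fset.

Lemma walkS n e e' :
  reflect (exists2 e1, e1 \in straight e & e' \in walk n e1) (e' \in walk n.+1 e).
Proof.
apply: (iffP (bigfcupP _ _ _ _)) => -[e1]; first by rewrite andbT; exists e1.
by move=> e1s e'w; exists e1; rewrite ?e1s.
Qed.

Lemma walk_descends n e e' : e' \in walk n e -> descends e' = descends e.
Proof.
elim: n e => [|n IH] e; first by rewrite inE => /eqP ->.
by move=> /walkS[e1]; rewrite in_straight => /andP[_ /eqP <-] /IH.
Qed.

Lemma walk_head n e e' : e' \in walk n e ->
  exists p, [/\ path adj (edge_head e) p, last (edge_head e) p = edge_head e' & size p = n].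
Proof.
elim: n e => [|n IH] e; first by rewrite inE => /eqP ->; exists [::].
move=> /walkS[e1]; rewrite in_straight => /andP[/andP[/eqP ee1 _] _] /IH[p [p1 p2 p3]].
by exists (edge_head e1 :: p); rewrite /= ee1 edge_adj p1 p2 p3.
Qed.

Lemma walk_tail n e e' : e' \in walk n e ->
  exists p, [/\ path adj (edge_tail e') p, last (edge_tail e') p = edge_tail e & size p = n].
Proof.
elim: n e => [|n IH] e; first by rewrite inE => /eqP ->; exists [::].
move=> /walkS[e1]; rewrite in_straight => /andP[/andP[/eqP ee1 _] _] /IH[p [p1 p2 p3]].
exists (rcons p (edge_tail e)); rewrite last_rcons size_rcons p3 rcons_path p1 p2.
by rewrite -ee1 adj_sym edge_adj.
Qed.

(** Going up, each step is forced: the next edge leads to the parent. *)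
Lemma walk_ascends_uniq n e e1 e2 : ~~ descends e ->
  e1 \in walk n e -> e2 \in walk n e -> e1 = e2.
Proof.
elim: n e => [|n IH] e ue; first by rewrite !inE => /eqP -> /eqP ->.
move=> /walkS[f1 f1e e1f] /walkS[f2 f2e e2f].
move: f1e f2e; rewrite !in_straight => /andP[/andP[/eqP f1e _] /eqP d1].
move=> /andP[/andP[/eqP f2e _] /eqP d2].
have f12 : f1 = f2 by apply: ascends_tail_inj; rewrite ?d1 ?d2// -f1e.
by apply: (IH f1) => //; [rewrite d1|rewrite f12].
Qed.

(** A descending walk read backwards goes up, so its end determines its start. *)
Lemma walk_descends_uniq n e1 e2 e : descends e ->
  e \in walk n e1 -> e \in walk n e2 -> e1 = e2.
Proof.
move=> de; elim: n e1 e2 => [|n IH] e1 e2; first by rewrite !inE => /eqP <- /eqP.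
move=> /walkS[f1 f1e e1f] /walkS[f2 f2e e2f].
have f12 := IH _ _ e1f e2f; rewrite -{}f12 in f2e.
move: f1e f2e; rewrite !in_straight => /andP[/andP[/eqP f1e _] /eqP d1].
move=> /andP[/andP[/eqP f2e _] /eqP d2].
have df1 : descends f1 by rewrite -(walk_descends e1f).
by apply: descends_head_inj; rewrite -?d1 -?d2// f1e.
Qed.

Lemma walk_disjoint n e e1 e2 e' : e1 \in straight e -> e2 \in straight e ->
  e' \in walk n e1 -> e' \in walk n e2 -> e1 = e2.
Proof.
move=> e1e e2e e1w e2w; have [de|ue] := boolP (descends e').
  exact: walk_descends_uniq de e1w e2w.
have ue1 : ~~ descends e1 by rewrite -(walk_descends e1w).
have ue0 : ~~ descends e by move: e1e; rewrite in_straight => /andP[_ /eqP <-].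
have in1 f : f \in straight e -> f \in walk 1 e.
  by move=> fe; apply/walkS; exists f => //; rewrite inE.
by apply: (walk_ascends_uniq ue0 (in1 _ e1e)); exact: in1.
Qed.

(** If [j] descends, its column has at most one [i], and the edges of that row are counted by their
    heads. If [j] ascends, the rows are singletons, and the edges of the column are counted by their
    tails. Either way one factor is 1 and the other at most [K]. *)
Lemma walk_schur n K :
  (forall v (X : {fset V}), (forall w, w \in X ->
    exists p, [/\ path adj v p, last v p = w & size p = n]) -> (#|` X| <= K)%N) ->
  schur_bound (walk n) K.
Proof.
move=> HK.
have HK' v (g : edge -> V) (X : {fset edge}) : {in X &, injective g} ->
    (forall e, e \in X ->
      exists p, [/\ path adj v p, last v p = g e & size p = n]) -> (#|` X| <= K)%N.
  move=> gi gX; rewrite -(card_in_imfset imfset_key gi).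
  by apply: (HK v) => w /imfsetP[e eX ->]; exact: gX.
move=> j A; rewrite -big_filter.
set s := seq.filter _ _; have us : uniq s by rewrite filter_uniq ?fset_uniq.
have [dj|uj] := boolP (descends j).
  case sE : s => [|i [|i' s']]; rewrite ?big_nil//.
    rewrite big_seq1.
    have : i \in s by rewrite sE mem_head.
    rewrite mem_filter => /andP[ji _].
    have di : descends i by rewrite -(walk_descends ji).
    apply: (HK' (edge_head i) (@edge_head _ _)); last by move=> e; exact: walk_head.
    by move=> e e' eX e'X; apply: descends_head_inj; rewrite (@walk_descends n i).
  have : i \in s by rewrite sE mem_head.
  have : i' \in s by rewrite sE !inE eqxx orbT.
  rewrite !mem_filter => /andP[ji' _] /andP[ji _].
  by move: us; rewrite sE (walk_descends_uniq dj ji ji') /= mem_head.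
apply: (@leq_trans (\sum_(i <- s) 1)).
  rewrite big_seq [leqRHS]big_seq; apply: leq_sum => i.
  rewrite mem_filter => /andP[ji _].
  have ui : ~~ descends i by rewrite -(walk_descends ji).
  have -> : walk n i = [fset j]%fset; last by rewrite cardfs1.
  apply/fsetP => e; rewrite inE; apply/idP/eqP => [ei|->//].
  exact: walk_ascends_uniq ui ei ji.
rewrite sum1_size.
have <- : #|` seq_fset tt s| = size s by rewrite size_seq_fset undup_id.
have sP i : i \in seq_fset tt s -> j \in walk n i.
  by rewrite seq_fsetE mem_filter => /andP[].
apply: (HK' (edge_tail j) (@edge_tail _ _)); last by move=> e /sP/walk_tail.
by move=> e e' /sP eX /sP e'X; apply: ascends_tail_inj; rewrite -(@walk_descends n _ j).
Qed.

End SameDirection.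
End RootedTree.

(** * Large spectral parameters *)

Section OuterSpectrum.
Variables (R : realType) (V : choiceType) (adj : rel V) (o : V).
Hypothesis treeT : is_tree adj.
Hypothesis finO : forall e : directed_edge adj, finite_set [set e' | nb_follows e e'].
Local Notation edge := (directed_edge adj).
Local Notation H := (ell2 R edge).
Local Notation descends := (descends o treeT).
Local Notation straight := (straight o treeT).
Local Notation turn := (turn o treeT).
Local Notation walk := (walk o treeT).
Implicit Types (f : H) (e : edge).

Lemma iter_straightE c n f e : schur_bound straight c ->
  iter n (rel_op straight) f e = \sum_(e' <- walk n e) f e'.
Proof.
move=> Sc; elim: n e => [|n IH] e; first by rewrite big_seq_fset1.
rewrite iterS (rel_opE _ _ Sc) /= big_bigfcup_disjoint ?fset_uniq//.
  by apply: eq_bigr => e1 _; exact: IH.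
move=> e1 e2 e1e e2e e'; exact: (walk_disjoint finO e1e e2e).
Qed.

(* Its operator [rel_op] is the projection onto the functions supported on
   descending edges. *)
Definition descending_part e : {fset edge} := if descends e then [fset e]%fset else fset0.

Lemma descending_part_schur : schur_bound descending_part 1.
Proof.
rewrite -[1%N]/(1 * 1)%N; apply: schur_bound_mul => [e|j A].
  by rewrite /descending_part; case: ifP; rewrite ?cardfs1 ?cardfs0.
apply: (@leq_trans (count_mem j A)); last by rewrite count_uniq_mem ?fset_uniq ?leq_b1.
by apply: sub_count => e; rewrite /descending_part/=; case: ifP; rewrite inE// eq_sym.
Qed.

Lemma outer_invertible c n K (l : R[i]) : (0 < n)%N ->
  schur_bound (@succs _ adj) c ->
  (forall v (X : {fset V}), (forall w, w \in X ->
    exists p, [/\ path adj v p, last v p = w & size p = n]) -> (#|` X| <= K)%N) ->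
  K%:R < (normc l ^+ n) ^+ 2 ->
  ell2_invertible (fun f => rel_op (@succs _ adj) f - l *: f).
Proof.
move=> n0 Oc HK Kl.
have Sc : schur_bound straight c.
  by apply: schur_bound_sub Oc => e e'; rewrite inE/= => /andP[].
have Xc : schur_bound turn c.
  by apply: schur_bound_sub Oc => e e'; rewrite inE/= => /andP[].
have Pc := descending_part_schur.
(* Split the successors of each edge by whether the direction is kept. *)
have ->: (fun f => rel_op (@succs _ adj) f - l *: f) =
    (fun f : H => rel_lin R Sc f + rel_lin R Xc f - l *: f).
  apply/funext => f; congr (_ - _); apply/val_inj/funext => e.
  rewrite /= (rel_opE _ _ Oc).
  rewrite [RHS](_ : _ = rel_op straight f e + rel_op turn f e)//.
  rewrite (rel_opE _ _ Sc) (rel_opE _ _ Xc).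
  rewrite (bigID (fun e' => descends e' == descends e))/=.
  congr (_ + _); apply/esym; exact: big_fset.
have walkK : schur_bound (walk n) K := walk_schur _ _ finO HK.
(* [P] is the projection onto descending edges: [L] preserves the direction, while [X] reads values
   on descending edges and is supported on ascending ones. *)
apply: (@ell2_invertible_triangular _ _ _ _ (rel_lin R Pc) _ (Num.sqrt c%:R)) => //.
- move=> f; apply/val_inj/funext => e /=.
  rewrite (rel_opE _ _ Pc) (rel_opE _ _ Sc) /descending_part.
  case: ifP => de.
    rewrite big_seq_fset1 (rel_opE _ _ Sc); apply: eq_big_seq => e'.
    rewrite (in_straight _ _ finO) (rel_opE _ _ Pc) /descending_part de => /andP[_ /eqP ->].
    by rewrite big_seq_fset1.
  rewrite big_seq_fset0 big_seq big1// => e'.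
  rewrite (in_straight _ _ finO) (rel_opE _ _ Pc) /descending_part de => /andP[_ /eqP ->].
  by rewrite big_seq_fset0.
- move=> f; apply/val_inj/funext => e /=.
  rewrite (rel_opE _ _ Xc) [RHS](rel_opE _ _ Xc).
  apply: eq_big_seq => e' /(turn_descends finO)[_ de'].
  by rewrite (rel_opE _ _ Pc) /descending_part de' big_seq_fset1.
- move=> f; apply/val_inj/funext => e /=.
  rewrite (rel_opE _ _ Pc) /descending_part; case: ifP => de; last by rewrite big_seq_fset0.
  rewrite big_seq_fset1 (rel_opE _ _ Xc) big_seq big1// => e' /(turn_descends finO)[].
  by rewrite de.
- by move=> f; exact: rel_op_norm.
(* The Schur test on [walk n] bounds the norm of [L ^ n] by [Num.sqrt K%:R], which is below
   [normc l ^+ n]. *)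
apply: (@ell2_invertible_outer _ _ _ _ (Num.sqrt c%:R) (Num.sqrt K%:R) n) => //.
- rewrite sqrtr_ge0/= -ltr_sqr ?nnegrE ?sqrtr_ge0 ?exprn_ge0 ?normc_ge0//.
  by rewrite sqr_sqrtr.
- by move=> f; exact: rel_op_norm.
- move=> f; apply: ell2_norm_le => [|A].
    by rewrite mulr_ge0 ?sqrtr_ge0 ?ell2_norm_ge0.
  under eq_bigr do rewrite (iter_straightE _ _ _ Sc).
  by rewrite exprMn ell2_norm_sqr sqr_sqrtr//; exact: rel_sum_sqr.
Qed.

End OuterSpectrum.

(** * Small spectral parameters *)

(* With [S] the sum of the [x i] and [a = S / (k - 1)], the left-hand side is
   [\sum x i ^+ 2 - (k - 2) * a ^+ 2]. *)
Lemma sum_sqr_reflection (R : realFieldType) (T : Type) (s : seq T) (x : T -> R) :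
  (1 < size s)%N ->
  \sum_(i <- s) ((size s).-1%:R^-1 * (\sum_(j <- s) x j) - x i) ^+ 2 <=
  \sum_(i <- s) x i ^+ 2.
Proof.
move=> s1; set S := \sum_(j <- s) x j; set a := _ * S.
have k0 : (size s).-1%:R != 0 :> R by rewrite pnatr_eq0; case: (size s) s1 => [|[]].
have SE : S = (size s).-1%:R * a by rewrite /a mulrA divff// mul1r.
have -> : \sum_(i <- s) (a - x i) ^+ 2 =
    \sum_(i <- s) x i ^+ 2 + \sum_(i <- s) (a ^+ 2 - 2 * a * x i).
  by rewrite -big_split; apply: eq_bigr => i _ /=; ring.
rewrite gerDl big_split/= sumrN big_const_seq count_predT iter_addr_0 -mulr_sumr -/S.
rewrite SE -[_ *+ size s]mulr_natl; case: (size s) s1 {k0 SE} => [|[|k]] // _.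
have -> : k.+2%:R * a ^+ 2 - 2 * a * (k.+2.-1%:R * a) = - (k%:R * a ^+ 2) :> R.
  by rewrite /= -!natr1; ring.
by rewrite oppr_le0 mulr_ge0// sqr_ge0.
Qed.

(** The coefficients are real, so real and imaginary parts are treated separately. *)
Lemma sum_normc_sqr_reflection (R : realType) (T : Type) (s : seq T) (x : T -> R[i]) :
  (1 < size s)%N ->
  \sum_(i <- s) normc (((size s).-1%:R^-1)%:C * (\sum_(j <- s) x j) - x i) ^+ 2 <=
  \sum_(i <- s) normc (x i) ^+ 2.
Proof.
move=> s1.
have ReM (r : R) z : complex.Re (r%:C * z) = r * complex.Re z.
  by case: z => a b /=; rewrite mul0r subr0.
have ImM (r : R) z : complex.Im (r%:C * z) = r * complex.Im z.
  by case: z => a b /=; rewrite mul0r addr0.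
under eq_bigr do rewrite normc_sqr !raddfB/= ReM ImM !raddf_sum/=.
under [leRHS]eq_bigr do rewrite normc_sqr.
by rewrite !big_split lerD// sum_sqr_reflection.
Qed.

Section InnerSpectrum.
Variables (R : realType) (V : choiceType) (adj : rel V).
Local Notation edge := (directed_edge adj).
Local Notation H := (ell2 R edge).
Hypothesis adj_sym : symmetric adj.
Hypothesis leafless : forall v : V, ~ is_leaf adj v.
Hypothesis finOut : forall v, finite_set [set e : edge | edge_tail e = v].
Implicit Types (f g : H) (e : edge) (v : V).

Fact rev_edge_subproof e : adj (edge_head e) (edge_tail e).
Proof. by rewrite adj_sym; exact: valP e. Qed.

Definition rev_edge e : edge :=
  exist (fun p : V * V => adj p.1 p.2) (edge_head e, edge_tail e) (rev_edge_subproof e).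

Lemma rev_edgeK : involutive rev_edge.
Proof. by move=> e; apply/val_inj => /=; rewrite -surjective_pairing. Qed.

Definition out v : {fset edge} := fset_set [set e : edge | edge_tail e = v].

Lemma in_out v e : (e \in out v) = (edge_tail e == v).
Proof. by rewrite in_fset_set//; apply/idP/eqP => [/set_mem|/mem_set]. Qed.

(** The edge [e] itself leaves the vertex; were it the only one, the vertex would be a leaf. *)
Lemma out_gt1 e : (1 < #|` out (edge_tail e)|)%N.
Proof.
have [w [ew wh]] : exists w, adj (edge_tail e) w /\ w != edge_head e.
  apply: contrapT => nw; apply: (@leafless (edge_tail e)); exists (edge_head e).
  apply/seteqP; split => [u /= eu|u ->]; last exact: (valP e).
  by apply/eqP/negPn/negP => uh; apply: nw; exists u.
pose e' : edge := exist (fun p : V * V => adj p.1 p.2) (edge_tail e, w) ew.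
have e'e : e' != e by apply: contra wh => /eqP <-.
apply: (@leq_trans #|` [fset e'; e]%fset|); first by rewrite cardfs2 e'e.
apply: fsubset_leq_card; apply/fsubsetP => x; rewrite !inE in_out.
by move=> /orP[] /eqP ->.
Qed.

Lemma finite_follows e : finite_set [set e' : edge | nb_follows e e'].
Proof.
by apply: sub_finite_set (finOut (edge_head e)) => e' /andP[/eqP ->].
Qed.

(** This is the form [J - 1]: among the edges leaving the head of [e], only the reverse of [e] is
    not a successor. *)
Lemma sum_succs (f : edge -> R[i]) e :
  \sum_(e' <- succs e) f e' = \sum_(e' <- out (edge_head e)) f e' - f (rev_edge e).
Proof.
rewrite [X in _ = X - _](big_fsetD1 (rev_edge e)) ?in_out//=.
rewrite [X in _ = X - _]addrC addrK.
apply: eq_fbigl => e'; rewrite !inE (in_succs finite_follows) in_out /nb_follows.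
by rewrite andbC [_ == edge_head e]eq_sym -[e' == rev_edge e]val_eqE.
Qed.

Let weight v : R[i] := ((#|` out v|.-1)%:R^-1 : R)%:C.

(** With [k] outgoing edges and weight [a = 1 / (k - 1)], this is [k a = 1 + a], the identity behind
    both inverse laws. *)
Let weightE e : #|` out (edge_tail e)|%:R * weight (edge_tail e)
  = 1 + weight (edge_tail e).
Proof.
rewrite /weight; case: #|` _| (out_gt1 e) => [|[|k]]//= _.
rewrite -natr1 mulrDl mul1r -(rmorph_nat (real_complex R)) -rmorphM.
by rewrite divff ?pnatr_eq0.
Qed.

(** The matrix [J / (k - 1) - 1] at the tail of [e], applied to [g] composed with edge reversal. *)
Definition nb_inv_fun (g : edge -> R[i]) e : R[i] :=
  weight (edge_tail e) * (\sum_(e' <- out (edge_tail e)) g (rev_edge e')) - g (rev_edge e).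

Lemma nb_inv_fun_sqr g (A : {fset edge}) :
  \sum_(e <- A) normc (nb_inv_fun g e) ^+ 2 <= fine (sqsum g).
Proof.
pose T := [fset edge_tail e | e in A]%fset.
have disj : {in T &, forall v w (e : edge), e \in out v -> e \in out w -> v = w}.
  by move=> v w _ _ e; rewrite !in_out => /eqP -> /eqP.
(* The reflection inequality needs all edges leaving a vertex, so [A] is enlarged to a disjoint
   union of full sets [out v]. *)
pose A' := (\bigcup_(v <- T) out v)%fset.
have AA' : {subset A <= A'}.
  move=> e eA; apply/bigfcupP; exists (edge_tail e); rewrite ?in_out// andbT.
  by apply/imfsetP; exists e.
apply: (@le_trans _ _ (\sum_(e <- A') normc (nb_inv_fun g e) ^+ 2)).
  rewrite (big_fset_of_sub _ AA') [leRHS](bigID (mem A))/= lerDl.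
  by apply: sumr_ge0 => e _; exact: sqr_ge0.
apply: (@le_trans _ _ (\sum_(e <- A') normc (g (rev_edge e)) ^+ 2)).
  rewrite !big_bigfcup_disjoint ?fset_uniq// big_seq [leRHS]big_seq.
  apply: ler_sum => v /imfsetP[e _ ->].
  rewrite (le_trans _ (sum_normc_sqr_reflection (fun e' => g (rev_edge e')) (out_gt1 e)))//.
  rewrite le_eqVlt; apply/orP; left; apply/eqP; apply: eq_big_seq => e'.
  by rewrite in_out => /eqP e'e; rewrite /nb_inv_fun e'e.
have rinj : {in A' &, injective rev_edge} by move=> x y _ _; exact: (inv_inj rev_edgeK).
have := sqsum_ge [fset rev_edge e | e in A']%fset (ell2_summable g).
by rewrite big_imfset.
Qed.

Lemma inner_invertible c (l : R[i]) :
  schur_bound (@succs _ adj) c -> normc l < 1 ->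
  ell2_invertible (fun f : H => rel_op (@succs _ adj) f - l *: f).
Proof.
move=> Oc l1.
pose C g : H := insubd (0 : H) (nb_inv_fun g).
have CE g e : C g e = nb_inv_fun g e.
  have gs : nb_inv_fun g \in @square_summable R edge.
    by apply: square_summableP => A; exact: nb_inv_fun_sqr.
  by have := val_insubd (0 : H) (nb_inv_fun g); rewrite gs /C/= => ->.
apply: (@ell2_invertible_inner _ _ (rel_lin R Oc) C l l1).
(* With [s] the sum of [f] over the [k] edges leaving the tail of [e], the values of the operator on
   their reverses sum to [k s - s]; weighted by [1 / (k - 1)] this is [s], and subtracting [s - f e]
   leaves [f e]. *)
- move=> f; apply/val_inj/funext => e /=; rewrite CE /nb_inv_fun.
  have BE e1 : rel_op (@succs _ adj) f (rev_edge e1) =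
      \sum_(e' <- out (edge_tail e1)) f e' - f e1.
    by rewrite (rel_opE _ _ Oc) sum_succs rev_edgeK.
  rewrite BE; under eq_big_seq => e1.
    rewrite in_out => /eqP e1e; rewrite BE e1e; over.
  rewrite sumrB big_const_seq count_predT iter_addr_0; set s := \sum_(e' <- _) _.
  rewrite -[s *+ _]mulr_natl -[X in _ * X - s]subr0.
  rewrite -/(#|` out (edge_tail e)|) mulrBr mulrA [weight _ * _]mulrC weightE.
  by ring.
- move=> g; apply/val_inj/funext => e /=.
  rewrite (rel_opE _ _ Oc) sum_succs CE /nb_inv_fun rev_edgeK.
  rewrite -[edge_tail (rev_edge e)]/(edge_head e).
  under eq_big_seq => e1.
    rewrite in_out => /eqP e1e; rewrite CE /nb_inv_fun e1e; over.
  rewrite sumrB big_const_seq count_predT iter_addr_0; set s := \sum_(e' <- _) _.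
  rewrite -mulr_natl mulrA.
  have := weightE (rev_edge e); rewrite -[edge_tail (rev_edge e)]/(edge_head e) => ->.
  by ring.
- move=> g; apply: ell2_norm_le => [|A]; first exact: ell2_norm_ge0.
  by under eq_bigr do rewrite CE; rewrite ell2_norm_sqr nb_inv_fun_sqr.
Qed.

End InnerSpectrum.

(** * Growth and the spectrum *)

Section Growth.
Variables (R : realType) (V : choiceType) (adj : rel V).
Hypothesis growth : (upper_growth adj R < +oo)%E.

(** A limsup below [x] puts the supremum over some tail below [x]; the index [n.+1] of that tail is
    positive, so the root can be undone by taking powers. *)
Lemma max_ball_lt (x : R) : 0 <= x -> (upper_growth adj R < x%:E)%E ->
  exists2 n, (0 < n)%N & (max_ball adj R n < (x ^+ n)%:E)%E.
Proof.
move=> x0; rewrite /upper_growth /limn_esup /limf_esup => /ereal_inf_lt[_ [A [n _ An] <-]] Ax.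
exists n.+1 => //.
have : (poweR (max_ball adj R n.+1) n.+1%:R^-1 < x%:E)%E.
  apply: le_lt_trans Ax; apply: ereal_sup_ubound; exists n.+1 => //.
  by apply: An => /=.
case: (max_ball _ _ _) => [a| |]; last by rewrite ltNyr.
- rewrite poweR_EFin !lte_fin; apply: contraTT; rewrite -!leNgt => xa.
  have xE : x = (x ^+ n.+1) `^ n.+1%:R^-1.
    by rewrite -powR_mulrn// -powRrM mulfV// powRr1.
  rewrite [leLHS]xE.
  by rewrite ge0_ler_powR// nnegrE ?invr_ge0 ?exprn_ge0// (le_trans _ xa)// exprn_ge0.
- by rewrite poweRyr// ltNge leey.
Qed.

Lemma card_sub_ball v n (X : {fset V}) : (max_ball adj R n < +oo)%E ->
  (forall w, w \in X -> exists p, [/\ path adj v p, last v p = w & size p = n]) ->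
  #|` X|%:R <= fine (max_ball adj R n).
Proof.
move=> Mn Xp.
have cM : (counting (graph_ball adj R v n) <= max_ball adj R n)%E.
  by apply: ereal_sup_ubound; exists v.
have finB : finite_set (graph_ball adj R v n).
  apply: contrapT => infB; move: (le_lt_trans cM Mn).
  by rewrite /counting asboolF.
rewrite -lee_fin fineK.
  apply: le_trans cM; rewrite /counting asboolT// lee_fin ler_nat.
  apply: fsubset_leq_card; apply/fsubsetP => w /Xp[p [vp pw pn]].
  rewrite in_fset_set// inE; apply: ereal_inf_lbound; exists p => //=.
  by rewrite pn.
by rewrite fin_real// Mn andbT (lt_le_trans _ cM)// /counting asboolT// ltNyr.
Qed.

Lemma finite_out v : finite_set [set e : directed_edge adj | edge_tail e = v].
Proof.
have [D /(_ v)[N vN _]] := bounded_degree growth.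
have [->|/set0P[e0 e0v]] := eqVneq [set e : directed_edge adj | edge_tail e = v] set0.
  exact: finite_set0.
apply: (@sub_finite_set _ _ ((fun w => insubd e0 (v, w)) @` [set` N])); last first.
  exact/finite_image/finite_fset.
move=> e /= ev; exists (edge_head e); first by apply: vN; rewrite -ev; exact: valP e.
have eE : (v, edge_head e) = val e by rewrite -ev [RHS]surjective_pairing.
by apply/val_inj; rewrite eE val_insubd (valP e).
Qed.

(** If [D] bounds the degrees, an edge has at most [D] successors, determined by their heads, and at
    most [D] predecessors, determined by their tails. *)
Lemma succs_schur : symmetric adj -> exists c, schur_bound (@succs _ adj) c.
Proof.
move=> adj_sym; have [D HD] := bounded_degree growth.
have inS := in_succs (finite_follows finite_out).
exists (D * D)%N; apply: schur_bound_mul => [e|j A].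
  have [N HN ND] := HD (edge_head e).
  apply: (key_size (k := @edge_head _ adj) ND (fset_uniq _)).
    move=> e1 e2; rewrite !inS => /andP[/eqP t1 _] /andP[/eqP t2 _].
    by apply: edge_eq; rewrite -t1.
  move=> e'; rewrite inS => /andP[/eqP t1 _]; apply: HN; rewrite t1; exact: valP e'.
rewrite -size_filter; have [N HN ND] := HD (edge_tail j).
apply: (key_size (k := @edge_tail _ adj) ND); first by rewrite filter_uniq ?fset_uniq.
  move=> e1 e2; rewrite !mem_filter !inS => /andP[/andP[/eqP t1 _] _].
  by move=> /andP[/andP[/eqP t2 _] _] t12; apply: edge_eq => //; rewrite t1.
move=> e'; rewrite mem_filter inS => /andP[/andP[/eqP t1 _] _].
by apply: HN; rewrite -t1 adj_sym; exact: valP e'.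
Qed.

(** Both sides use the same default, so it is enough to compare the sums, with no summability
    check. *)
Lemma nonbacktracking_rel_op f : nonbacktracking adj R f = rel_op (@succs _ adj) f.
Proof.
rewrite /nonbacktracking /rel_op; congr (insubd _ _); apply/funext => e.
by rewrite /nb_sum fsbig_finite//; exact: finite_follows finite_out e.
Qed.

End Growth.

Theorem theorem4p2 (R : realType) (V : choiceType) (T : rel V)
    (treeT : is_tree T) (leaflessT : forall v : V, ~ is_leaf T v)
    (growthT : (upper_growth T R < +oo)%E) :
  spectrum (nonbacktracking T R) `<=`
    [set lambda : R[i] |
      1 <= normc lambda <= Num.sqrt (fine (upper_growth T R))].
Proof.
have [[T_sym _] [ o ] _ _] := treeT.
have [c Tc] := succs_schur growthT T_sym.
move=> l /= sl; apply/negPn/negP => nl; apply: sl.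
rewrite [X in has_bounded_inverse X](_ : _ = fun f => rel_lin R Tc f - l *: f); last first.
  by apply/funext => f; rewrite nonbacktracking_rel_op.
apply: has_bounded_inverse_ell2.
move: nl; rewrite negb_and -!ltNge => /orP[l1|lg].
  by have := inner_invertible T_sym leaflessT (finite_out growthT) Tc l1.
(* Squaring the bound on [normc l] requires a nonnegative growth; the values minus infinity and
   negative reals are handled separately. *)
have gl : (upper_growth T R < (normc l ^+ 2)%:E)%E.
  move: growthT lg; case: (upper_growth T R) => [g| |]//= _ gl; last exact: ltNyr.
  rewrite lte_fin; have [g0|g0] := leP 0 g; last exact: lt_le_trans g0 (sqr_ge0 _).
  by rewrite -[ltLHS]sqr_sqrtr// ltr_sqr ?nnegrE ?sqrtr_ge0 ?normc_ge0.
have [n n0 Mn] := max_ball_lt (sqr_ge0 (normc l)) gl.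
have Mfin : (max_ball T R n < +oo)%E by exact: lt_trans Mn (ltry _).
have M0 : (0 <= max_ball T R n)%E.
  apply: le_trans (ereal_sup_ubound (imageT (fun v => counting (graph_ball T R v n)) o)).
  by rewrite /= /counting; case: ifP => _; rewrite ?lee_fin ?leey.
have MnE : max_ball T R n = (fine (max_ball T R n))%:E.
  by rewrite fineK// ge0_fin_numE.
(* Ball sizes are suprema in the extended reals, whereas [K] is a natural number. Truncation loses
   nothing for cardinalities and keeps [K] below [(normc l ^+ n) ^+ 2]. *)
apply: (outer_invertible o treeT (finite_follows (finite_out growthT)) n0 Tc
  (K := Num.truncn (fine (max_ball T R n)))) => [v X Xp|].
  by rewrite truncn_ge_nat ?fine_ge0//; exact: card_sub_ball Xp.
rewrite -exprM mulnC exprM -lte_fin; apply: le_lt_trans Mn.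
by rewrite [leRHS]MnE lee_fin truncn_le// fine_ge0.
Qed.
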